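(* Let $$\mathcal{T} = \left\{ t \in \mathbb{C} \;:\; |t|^{1/2}|1-t| + |t|^2 < 1 \ \text{ and } \ |t|^{1/2}|1 - t + t^2| + |t|^3 < 1 \right\},$$ an open subset of the open unit disc. If $w \in \mathrm{Br}_3$ is positive and is not a power of $\sigma_1$ or $\sigma_2$, then $R_w$ is disjoint from $\mathcal{T}$.
   Context: $\mathrm{Br}_3 = \langle \sigma_1, \sigma_2 \mid \sigma_1\sigma_2\sigma_1 = \sigma_2\sigma_1\sigma_2\rangle$ is the 3-strand braid group; $w$ is positive if it is a product of positive powers of $\sigma_1,\sigma_2$. Powers of $\sigma_i$ include the identity $\sigma_i^0$. The reduced Burau representation $B_t : \mathrm{Br}_3 \to \mathrm{GL}_2(\mathbb{Z}[t^{\pm1}])$ is given by $B_t(\sigma_1) = \begin{pmatrix} -t & 1\\ 0 & 1\end{pmatrix}$, $B_t(\sigma_2) = \begin{pmatrix} 1 & 0 \\ t & -t\end{pmatrix}$. For a positive braid $w$, the entries of $B_t(w)$ are polynomials in $t$, and for $t \in \mathbb{C}$, $\rho_w(t)$ denotes the spectral radius (largest absolute value of an eigenvalue) of the complex matrix $B_t(w)$. Put $\overline{\mathbb{D}} = \{z \in \mathbb{C} : |z| \le 1\}$ and $R_w = \{z \in \overline{\mathbb{D}} : \rho_w(z) = 1\}$. *)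

(* Defs.v *)
From HB Require Import structures.
From mathcomp Require Import all_boot all_order all_algebra.
From mathcomp Require Import all_classical all_reals all_analysis.
From mathcomp Require Import complex ring.

Set Implicit Arguments.
Unset Strict Implicit.
Unset Printing Implicit Defensive.

Import Order.TTheory GRing.Theory Num.Theory.
Import numFieldNormedType.Exports.

Local Open Scope classical_set_scope.
Local Open Scope complex_scope.
Local Open Scope ring_scope.
Local Open Scope quotient_scope.

Local Notation "x %:F" := (tofrac x) : ring_scope.

(* A letter (i, e) stands for sigma_1 (i = false) or sigma_2 (i = true) if
   e = false, and for its inverse if e = true. *)
Definition braid_word := seq (bool * bool).

Inductive braid_equiv : braid_word -> braid_word -> Prop :=
| braid_refl u : braid_equiv u u
| braid_sym u v : braid_equiv u v -> braid_equiv v u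
| braid_trans u v w : braid_equiv u v -> braid_equiv v w -> braid_equiv u w
| braid_cat u u' v v' :
    braid_equiv u u' -> braid_equiv v v' -> braid_equiv (u ++ v) (u' ++ v')
| braid_cancel i e : braid_equiv [:: (i, e); (i, ~~ e)] [::]
| braid_rel :
    braid_equiv [:: (false, false); (true, false); (false, false)]
                [:: (true, false); (false, false); (true, false)].

Definition braid_eqb (u v : braid_word) : bool := `[< braid_equiv u v >].

Lemma braid_eqb_refl : reflexive braid_eqb.
Proof. by move=> u; apply/asboolP; exact: braid_refl. Qed.

Lemma braid_eqb_sym : symmetric braid_eqb.
Proof. by move=> u v; apply/asboolP/asboolP; exact: braid_sym. Qed.

Lemma braid_eqb_trans : transitive braid_eqb.
Proof.
by move=> v u w /asboolP uv /asboolP vw; apply/asboolP; exact: braid_trans vw.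
Qed.

Canonical braid_equiv_rel :=
  EquivRel braid_eqb braid_eqb_refl braid_eqb_sym braid_eqb_trans.

Definition Br3 := {eq_quot braid_eqb}.
HB.instance Definition _ := Choice.on Br3.
HB.instance Definition _ := EqQuotient.on Br3.

Lemma Br3_eqP u v : braid_equiv u v <-> \pi_Br3 u = \pi_Br3 v.
Proof.
split=> [uv|/eqmodP/asboolP//].
by apply/eqmodP/asboolP.
Qed.

Lemma Br3_repr u : braid_equiv (repr (\pi_Br3 u)) u.
Proof. by apply/Br3_eqP; rewrite reprK. Qed.

Definition word_inv (u : braid_word) : braid_word :=
  rev [seq (l.1, ~~ l.2) | l <- u].

Lemma word_inv_cat u v : word_inv (u ++ v) = word_inv v ++ word_inv u.
Proof. by rewrite /word_inv map_cat rev_cat. Qed.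

Lemma word_invK : involutive word_inv.
Proof.
move=> u; rewrite /word_inv map_rev revK -map_comp -[RHS]map_id.
by apply: eq_map => -[i e] /=; rewrite negbK.
Qed.

Lemma word_mulV u : braid_equiv (u ++ word_inv u) [::].
Proof.
elim: u => [|[i e] u IH]; first exact: braid_refl.
rewrite -cat1s word_inv_cat -catA (catA u).
apply: braid_trans (braid_cancel i e).
apply: (@braid_cat [:: (i, e)] [:: (i, e)]); first exact: braid_refl.
by rewrite -[X in braid_equiv _ X]cat0s; apply: braid_cat IH _; exact: braid_refl.
Qed.

Lemma word_Vmul u : braid_equiv (word_inv u ++ u) [::].
Proof. by rewrite -{2}[u]word_invK; exact: word_mulV. Qed.

Lemma word_inv_equiv u v : braid_equiv u v -> braid_equiv (word_inv u) (word_inv v).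
Proof.
move=> uv; have r := braid_refl.
apply: braid_trans (_ : braid_equiv _ (word_inv u ++ (v ++ word_inv v))) _.
  rewrite -[X in braid_equiv X _]cats0; apply: braid_cat (r _) _.
  exact/braid_sym/word_mulV.
rewrite catA -[X in braid_equiv _ X]cat0s; apply: braid_cat (r _).
apply: braid_trans (word_Vmul u); apply: braid_cat (r _) _.
exact: braid_sym.
Qed.

Definition Br3_one : Br3 := \pi_Br3 [::].
Definition Br3_mul (x y : Br3) : Br3 := \pi_Br3 (repr x ++ repr y).
Definition Br3_inv (x : Br3) : Br3 := \pi_Br3 (word_inv (repr x)).

Lemma Br3_mul_pi u v : Br3_mul (\pi_Br3 u) (\pi_Br3 v) = \pi_Br3 (u ++ v).
Proof. by apply/Br3_eqP; apply: braid_cat; exact: Br3_repr. Qed.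

Lemma Br3_inv_pi u : Br3_inv (\pi_Br3 u) = \pi_Br3 (word_inv u).
Proof. by apply/Br3_eqP; apply: word_inv_equiv; exact: Br3_repr. Qed.

Lemma Br3W (P : Br3 -> Prop) : (forall u, P (\pi_Br3 u)) -> forall x, P x.
Proof. by move=> Pu x; rewrite -[x]reprK. Qed.

Lemma Br3_mulA : associative Br3_mul.
Proof.
by elim/Br3W=> u; elim/Br3W=> v; elim/Br3W=> w; rewrite !Br3_mul_pi catA.
Qed.

Lemma Br3_mul1g : left_id Br3_one Br3_mul.
Proof. by elim/Br3W=> u; rewrite Br3_mul_pi. Qed.

Lemma Br3_mulg1 : right_id Br3_one Br3_mul.
Proof. by elim/Br3W=> u; rewrite Br3_mul_pi cats0. Qed.

Lemma Br3_mulVg : left_inverse Br3_one Br3_inv Br3_mul.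
Proof.
by elim/Br3W=> u; rewrite Br3_inv_pi Br3_mul_pi; apply/Br3_eqP/word_Vmul.
Qed.

Lemma Br3_mulgV : right_inverse Br3_one Br3_inv Br3_mul.
Proof.
by elim/Br3W=> u; rewrite Br3_inv_pi Br3_mul_pi; apply/Br3_eqP/word_mulV.
Qed.

HB.instance Definition _ := isGroup.Build Br3
  Br3_mulA Br3_mul1g Br3_mulg1 Br3_mulVg Br3_mulgV.

Definition sigma1 : Br3 := \pi_Br3 [:: (false, false)].
Definition sigma2 : Br3 := \pi_Br3 [:: (true, false)].

Lemma Br3_piM u v : \pi_Br3 (u ++ v) = (\pi_Br3 u * \pi_Br3 v)%g.
Proof. by rewrite -Br3_mul_pi. Qed.

Lemma sigma_braid : (sigma1 * sigma2 * sigma1 = sigma2 * sigma1 * sigma2)%g.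
Proof.
rewrite /sigma1 /sigma2.
rewrite -!Br3_piM.
exact/Br3_eqP/braid_rel.
Qed.

Definition positive (w : Br3) : Prop :=
  exists s : seq bool,
    w = (\big[*%g/1]_(i <- s) (if i then sigma2 else sigma1))%g.

Definition is_power_of (x w : Br3) : Prop :=
  exists k : nat, w = (x ^+ k)%g \/ w = (x ^- k)%g.

Definition mx22 (T : Type) (a b c d : T) : 'M[T]_2 :=
  \matrix_(i, j) (if i == 0 then if j == 0 then a else b
                  else if j == 0 then c else d).

Definition burau_gen (i : bool) : 'M[{poly int}]_2 :=
  if i then mx22 1 0 'X (- 'X) else mx22 (- 'X) 1 0 1.

(* Z[t, t^-1] is realized inside the fraction field of Z[t]; see
   burau_laurent below. *)
Definition toF (A : 'M[{poly int}]_2) : 'M[{fraction {poly int}}]_2 :=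
  map_mx (@tofrac {poly int}) A.

Definition burau_letter (l : bool * bool) : 'M[{fraction {poly int}}]_2 :=
  if l.2 then (toF (burau_gen l.1))^-1 else toF (burau_gen l.1).

Definition burau_word (u : braid_word) : 'M[{fraction {poly int}}]_2 :=
  \prod_(l <- u) burau_letter l.

Definition burau (w : Br3) : 'M[{fraction {poly int}}]_2 :=
  burau_word (repr w).

Lemma burau_gen_det i : \det (burau_gen i) = - 'X.
Proof.
rewrite (expand_det_row _ ord0) !big_ord_recl big_ord0 /cofactor !det_mx11.
by case: i; rewrite !mxE /= ?expr0 ?expr1; ring.
Qed.

Lemma mx_unit_det (F : fieldType) n (A : 'M[F]_n.+1) :
  (A \is a GRing.unit) = (\det A != 0).
Proof. by rewrite -[_ \is a _]/(A \in unitmx) unitmxE unitfE. Qed.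

Lemma toF_det A : \det (toF A) = (\det A)%:F.
Proof. by rewrite /toF det_map_mx. Qed.

Lemma toFM A B : toF (A * B) = toF A * toF B.
Proof. exact: map_mxM. Qed.

Lemma toF1 : toF 1 = 1.
Proof. exact: map_mx1. Qed.

Lemma burau_gen_unit i : toF (burau_gen i) \is a GRing.unit.
Proof.
by rewrite mx_unit_det toF_det burau_gen_det tofrac_eq0 oppr_eq0 polyX_eq0.
Qed.

Lemma burau_letter_unit l : burau_letter l \is a GRing.unit.
Proof. by rewrite /burau_letter; case: l.2; rewrite ?unitrV burau_gen_unit. Qed.

Lemma burau_word_equiv u v : braid_equiv u v -> burau_word u = burau_word v.
Proof.
elim=> {u v} [//|u v _ ->//|u v w _ -> _ ->//|u u' v v' _ uu' _ vv'|i e|].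
- by rewrite /burau_word !big_cat /= -!/(burau_word _) uu' vv'.
- rewrite /burau_word big_cons big_seq1 big_nil /burau_letter /=.
  by case: e => /=; rewrite ?mulVr ?mulrV ?burau_gen_unit.
- rewrite /burau_word !big_cons !big_nil /burau_letter /= !mulr1.
  rewrite -!toFM; congr toF.
  apply/matrixP => i j; rewrite !mxE !big_ord_recl !big_ord0 !mxE.
  rewrite !big_ord_recl !big_ord0 !mxE /=.
  by case: (i == 0); case: (j == 0); ring.
Qed.

Lemma burau_pi u : burau (\pi_Br3 u) = burau_word u.
Proof. by apply: burau_word_equiv; exact: Br3_repr. Qed.

Lemma burau1 : burau 1%g = 1.
Proof. by rewrite burau_pi /burau_word big_nil. Qed.

Lemma burauM x y : burau (x * y)%g = burau x * burau y.
Proof.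
elim/Br3W: x => u; elim/Br3W: y => v.
by rewrite -Br3_piM !burau_pi /burau_word big_cat.
Qed.

Lemma burau_sigma1 : burau sigma1 = toF (mx22 (- 'X) 1 0 1).
Proof. by rewrite burau_pi /burau_word big_seq1. Qed.

Lemma burau_sigma2 : burau sigma2 = toF (mx22 1 0 'X (- 'X)).
Proof. by rewrite burau_pi /burau_word big_seq1. Qed.

Definition is_laurent (f : {fraction {poly int}}) : Prop :=
  exists (p : {poly int}) (n : nat), f = p%:F / 'X%:F ^+ n.

Lemma is_laurentD f g : is_laurent f -> is_laurent g -> is_laurent (f + g).
Proof.
have X0 n : ('X%:F : {fraction {poly int}}) ^+ n != 0.
  by rewrite expf_neq0// tofrac_eq0 polyX_eq0.
move=> [p [n ->]] [q [m ->]]; exists (p * 'X^m + q * 'X^n), (n + m)%N.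
by rewrite addf_div // exprD rmorphD !rmorphM !rmorphXn.
Qed.

Lemma is_laurentM f g : is_laurent f -> is_laurent g -> is_laurent (f * g).
Proof.
move=> [p [n ->]] [q [m ->]]; exists (p * q), (n + m)%N.
by rewrite mulf_div exprD rmorphM.
Qed.

Lemma is_laurent_tofrac p : is_laurent p%:F.
Proof. by exists p, 0; rewrite expr0 divr1. Qed.

Lemma mx_invE (F : fieldType) n (A : 'M[F]_n.+1) i j :
  A \is a GRing.unit -> A^-1 i j = (\det A)^-1 * (\adj A) i j.
Proof. by move=> uA; rewrite -[A^-1]/(invmx A) /invmx uA mxE. Qed.

Lemma toF_adj A : \adj (toF A) = toF (\adj A).
Proof. by rewrite /toF map_mx_adj. Qed.

Lemma burau_letter_laurent l i j : is_laurent (burau_letter l i j).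
Proof.
rewrite /burau_letter; case: l.2; last by rewrite mxE; exact: is_laurent_tofrac.
rewrite mx_invE ?burau_gen_unit// toF_adj toF_det burau_gen_det.
apply: is_laurentM; last by rewrite mxE; exact: is_laurent_tofrac.
by exists (-1), 1; rewrite expr1 tofracN tofracN tofrac1 invrN mulN1r.
Qed.

(* As burau w^-1 is the inverse of burau w, this says that burau takes its
   values in GL_2(Z[t, t^-1]). *)
Lemma burau_laurent w i j : is_laurent (burau w i j).
Proof.
rewrite /burau /burau_word; elim: (repr w) i j => [|l u IH] i j.
  rewrite big_nil mxE; case: (i == j); [exists 1|exists 0]; exists 0;
  by rewrite expr0 divr1 ?tofrac1 ?tofrac0.
rewrite big_cons mxE; apply: (big_ind is_laurent) => [|f g|k _].
- by rewrite -tofrac0; exact: is_laurent_tofrac.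
- exact: is_laurentD.
- exact: is_laurentM (burau_letter_laurent _ _ _) (IH _ _).
Qed.

(* The matrix over Z[t] equal to burau w, when there is one (it is then
   unique); junk otherwise. *)
Definition burau_poly (w : Br3) : 'M[{poly int}]_2 :=
  xget 0 [set A | toF A = burau w].

Lemma toF_inj : injective toF.
Proof.
move=> A B /matrixP AB; apply/matrixP => i j.
by have /eqP := AB i j; rewrite !mxE tofrac_eq => /eqP.
Qed.

Lemma burau_prod_gen (s : seq bool) :
  burau (\big[*%g/1]_(i <- s) (if i then sigma2 else sigma1))%g =
  toF (\prod_(i <- s) burau_gen i).
Proof.
elim: s => [|i s IH]; first by rewrite !big_nil burau1 toF1.
rewrite !big_cons burauM IH toFM; congr (_ * _).
by case: i; rewrite ?burau_sigma1 ?burau_sigma2.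
Qed.

Lemma burau_polyE w A : toF A = burau w -> burau_poly w = A.
Proof.
move=> Aw; apply: toF_inj; rewrite Aw /burau_poly.
exact: (@xgetPex _ 0 [set B | toF B = burau w] (ex_intro _ A Aw)).
Qed.

Lemma burau_poly_positive w : positive w -> toF (burau_poly w) = burau w.
Proof.
by case=> s ->; rewrite burau_prod_gen; congr toF; exact/burau_polyE/esym/burau_prod_gen.
Qed.

(* The matrix B_t(w), for w positive. *)
Definition burau_at (R : realType) (w : Br3) (t : R[i]) : 'M[R[i]]_2 :=
  map_mx (fun p : {poly int} => (map_poly intr p).[t]) (burau_poly w).

(* The norm of R[i] takes its values in R[i]. *)
Definition spectral_radius (R : realType) (n : nat) (A : 'M[R[i]]_n) : R :=
  sup [set r : R | exists2 a : R[i], eigenvalue A a & `|a| = r%:C].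

Lemma spectral_radius_max (R : realType) (n : nat) (A : 'M[R[i]]_n.+1) :
  (exists2 a, eigenvalue A a & `|a| = (spectral_radius A)%:C) /\
  (forall a, eigenvalue A a -> `|a| <= (spectral_radius A)%:C).
Proof.
have [rs] := closed_field_poly_normal (char_poly A).
rewrite (monicP (char_poly_monic A)) scale1r => rsE.
have evE a : eigenvalue A a = (a \in rs).
  by rewrite eigenvalue_root_char rsE root_prod_XsubC.
have rs0 : rs != [::].
  apply/eqP => rs0; have := size_char_poly A.
  by rewrite rsE rs0 big_nil size_poly1.
have [a ars amax] : exists2 a, a \in rs & forall b, b \in rs -> `|b| <= `|a|.
  elim: rs rs0 {rsE evE} => // x [|y s] IH _.
    by exists x; rewrite ?mem_head// => b; rewrite inE => /eqP ->.
  have [//|a ays amax] := IH.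
  have /orP[xa|ax] := real_leVge (normr_real x) (normr_real a).
    exists a; first by rewrite inE ays orbT.
    by move=> b; rewrite inE => /predU1P[->//|]; exact: amax.
  exists x; first exact: mem_head.
  by move=> b; rewrite inE => /predU1P[->//|/amax]; move/le_trans; exact.
have normE b : `|b| = (complex.Re `|b|)%:C :> R[i] by rewrite RRe_real ?normr_real.
have sE : spectral_radius A = complex.Re `|a|.
  apply/eqP; rewrite eq_le; apply/andP; split.
    apply: ge_sup; first by exists (complex.Re `|a|), a; rewrite ?evE.
    move=> r [b]; rewrite evE => /amax + bE; rewrite bE [`|a|]normE.
    by rewrite lecR.
  apply: ub_le_sup; last by exists a; rewrite ?evE.
  exists (complex.Re `|a|) => r [b]; rewrite evE => /amax + bE.
  by rewrite bE [`|a|]normE lecR.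
split; first by exists a; rewrite ?evE// sE.
by move=> b; rewrite evE sE -normE; exact: amax.
Qed.

Definition rho (R : realType) (w : Br3) (t : R[i]) : R :=
  spectral_radius (burau_at w t).

Definition R_set (R : realType) (w : Br3) : set R[i] :=
  [set z | `|z| <= 1 /\ rho w z = 1].

Definition T_set (R : realType) : set R[i] :=
  [set t | sqrtC `|t| * `|1 - t| + `|t| ^+ 2 < 1 /\
           sqrtC `|t| * `|1 - t + t ^+ 2| + `|t| ^+ 3 < 1].

Arguments R_set R w : clear implicits.
Arguments T_set R : clear implicits.

(* Main.v *)
Require Import Defs.
From mathcomp Require Import all_boot all_order all_algebra.
From mathcomp Require Import all_classical all_reals all_analysis.
From mathcomp Require Import complex ring.
Import Order.TTheory GRing.Theory Num.Theory.
Import numFieldNormedType.Exports.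

Local Open Scope classical_set_scope.
Local Open Scope complex_scope.
Local Open Scope ring_scope.

(** Fix t and a square root r of t. If t <> 0, conjugation by diag(r, 1) turns
    B_t(sigma_1) into S = [[-t, r], [0, 1]] and B_t(sigma_2) into J S J, where J
    exchanges the two coordinates; so a positive braid acts as a word in S and J
    (and if t = 0, it has the same characteristic polynomial as that word, see
    [burau_shear_prod]).
    Up to the scalar -r^3, J is the image of the Garside element
    sigma_1 sigma_2 sigma_1, that is, S J S J S = -r^3 J
    ([shear_swap_garside]). This is the source of all cancellations.

    For a row vector (x, y), (x, y) S^a J = (r [a] x + y, (-t)^a x), where
    [a] = 1 - t + t^2 - ... has a terms. In the l1 norm the coordinate x is thus
    multiplied by at most c(a) = |r [a]| + |t|^a, while y is moved to the first
    place unchanged. The two inequalities that define the region say that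
    c(2) < 1 and c(3) < 1, and c(a + b) <= c(a) as soon as c(b) <= 1, so that
    c(a) < 1 for all a >= 2 ([cost_lt1]). As c(0) = 1, the only exponent for
    which S^a J can expand the norm is a = 1, and then by at most 2.

    An exponent 1 between two positive exponents can be removed:
    S^(a+1) J S J S^(b+1) J = -r^3 S^a J S^b J ([blocks_garside]). Rewriting
    with this relation and J^2 = 1, every word in S and J becomes, up to a
    scalar of modulus at most 1, a word with at most two exponents 1, hence of
    norm at most 4 ([l1norm_blocks_le4]). Powers of words are words, so all
    eigenvalues of words have modulus at most 1 ([eigenvalue_blocks_le1]).

    A braid that contains both generators is conjugate to one that starts with
    sigma_1 and ends with sigma_2, and such a braid is a product of factors
    S^a J with all a >= 1 ([blocks_of_word]). If all exponents are at least 2,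
    the square of the product contracts the norm strictly. Otherwise the cube of
    the product contains an exponent 1 between positive exponents, so the cube
    is -r^3 times a word and the eigenvalues satisfy |x|^3 <= |r|^3 < 1. Either
    way the spectral radius is less than 1 ([eigenvalue_blocks_lt1]). *)

Set Implicit Arguments.
Unset Strict Implicit.

(** * The generators in terms of a shear and a swap *)

Lemma mx22M (K : pzRingType) (a b c d a' b' c' d' : K) :
  mx22 a b c d * mx22 a' b' c' d' =
  mx22 (a * a' + b * c') (a * b' + b * d') (c * a' + d * c') (c * b' + d * d').
Proof.
apply/matrixP => i j; rewrite !mxE !big_ord_recl big_ord0 !mxE /= addr0.
by case: (i == 0); case: (j == 0).
Qed.

Lemma mx22Z (K : pzRingType) (k a b c d : K) :
  k *: mx22 a b c d = mx22 (k * a) (k * b) (k * c) (k * d).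
Proof. by apply/matrixP => i j; rewrite !mxE; case: (i == 0); case: (j == 0). Qed.

Lemma mx22_1 (K : pzRingType) : 1 = mx22 1 0 0 1 :> 'M[K]_2.
Proof.
apply/matrixP => i j; rewrite !mxE.
by case: i => [[|[|//]] ?]; case: j => [[|[|//]] ?].
Qed.

Section Words.
Context {K : comNzRingType}.
Implicit Types (r : K) (l : seq nat) (a b : nat) (s : seq bool).

(** This is B_t(sigma_1) conjugated by diag(r, 1), where t = r^2; the conjugate
    of B_t(sigma_2) is then [swap * shear r * swap]. *)
Definition shear r : 'M[K]_2 := mx22 (- r ^+ 2) r 0 1.
Definition swap : 'M[K]_2 := mx22 0 1 1 0.
Definition block r a : 'M[K]_2 := shear r ^+ a * swap.
Definition blocks r l : 'M[K]_2 := \prod_(a <- l) block r a.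

Lemma swapK : swap * swap = 1.
Proof. by rewrite mx22M mx22_1; congr mx22; ring. Qed.

Lemma swapKl (M : 'M[K]_2) : swap * (swap * M) = M.
Proof. by rewrite mulrA swapK mul1r. Qed.

(** The braid sigma_1 sigma_2 sigma_1 exchanges the two generators by
    conjugation, so its image has to be a multiple of the swap. *)
Lemma shear_swap_garside r :
  shear r * swap * shear r * swap * shear r = (- r ^+ 3) *: swap.
Proof. by rewrite !mx22M mx22Z; congr mx22; ring. Qed.

Lemma blocks_nil r : blocks r [::] = 1.
Proof. exact: big_nil. Qed.

Lemma blocks_cons r a l : blocks r (a :: l) = block r a * blocks r l.
Proof. exact: big_cons. Qed.

Lemma blocks_cat r l1 l2 : blocks r (l1 ++ l2) = blocks r l1 * blocks r l2.
Proof. exact: big_cat. Qed.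

Lemma blockS r a : block r a.+1 = shear r * block r a.
Proof. by rewrite /block exprS -mulrA. Qed.

Lemma block0 r : block r 0 = swap.
Proof. by rewrite /block mul1r. Qed.

(** An exponent 1 is the obstacle to contraction; between positive exponents
    the Garside relation removes it and gains the scalar. *)
Lemma blocks_garside r a b l1 l2 :
  blocks r (l1 ++ [:: a.+1, 1, b.+1 & l2]) =
  (- r ^+ 3) *: blocks r (l1 ++ [:: a, b & l2]).
Proof.
rewrite !blocks_cat !blocks_cons scalerAr; congr (_ * _).
rewrite (blockS r b) /block exprSr expr1.
transitivity (shear r ^+ a * (shear r * swap * shear r * swap * shear r) *
              (shear r ^+ b * swap) * blocks r l2); first by rewrite !mulrA.
by rewrite shear_swap_garside -scalerAr -!scalerAl !mulrA.
Qed.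

Definition shear_letter r (i : bool) : 'M[K]_2 :=
  if i then swap * shear r * swap else shear r.

(** The list consists of the run lengths of the word: a swap appears each time
    the letter changes. The word ends with sigma_2 because the last run must be
    followed by a swap; the power of [swap] in front carries the letter that
    comes first, which is what makes the induction go through. *)
Lemma blocks_of_word r s (x : bool) :
  exists2 l, (l != [::]) && all (leq 1) l &
    swap ^+ x * \prod_(i <- x :: rcons s true) shear_letter r i = blocks r l.
Proof.
elim: s x => [|y s IH] x.
  case: x; [exists [:: 2] | exists [:: 1; 1]] => //; rewrite big_cons big_seq1.
    by rewrite expr1 !blocks_cons blocks_nil mulr1 !blockS block0 /= !mulrA
               swapK mul1r -(mulrA (shear r)) swapK mulr1.
  by rewrite expr0 mul1r !blocks_cons blocks_nil mulr1 !blockS block0 /= !mulrA.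
have letterE (u : bool) M : swap ^+ u * (shear_letter r u * M) =
    shear r * (swap ^+ u * M).
  by case: u; rewrite ?expr1 ?expr0 ?mul1r // /shear_letter -!mulrA swapKl.
have [l /andP[l0 l1] wE] := IH y.
rewrite rcons_cons big_cons letterE.
have [->|neq_xy] := eqVneq x y.
  rewrite wE; case: l l0 l1 {wE} => // a l _ /= /andP[_ l1].
  by exists (a.+1 :: l); rewrite ?blocks_cons ?blockS ?mulrA //= l1 blockS mulrA.
have -> : swap ^+ x = swap * swap ^+ y.
  by case: x y neq_xy {IH wE} => -[] // _; rewrite ?expr1 ?expr0 ?mulr1 ?swapK.
rewrite -mulrA wE; exists (1 :: l); first by rewrite /= l1.
by rewrite blocks_cons blockS block0 mulrA.
Qed.

(** The quantum integer of a at q = - r^2. *)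
Definition qint r a : K := \sum_(i < a) (- r ^+ 2) ^+ i.

Lemma shearX r a : shear r ^+ a = mx22 ((- r ^+ 2) ^+ a) (r * qint r a) 0 1.
Proof.
elim: a => [|a IH]; first by rewrite !expr0 mx22_1 /qint big_ord0 mulr0.
rewrite exprSr IH mx22M [qint r a.+1]big_ord_recr /= -/(qint r a) (exprSr _ a).
by move: (_ ^+ a) => u; congr mx22; ring.
Qed.

Lemma qintD r a b : qint r (a + b) = qint r a + (- r ^+ 2) ^+ a * qint r b.
Proof.
rewrite /qint big_split_ord; congr (_ + _).
by rewrite big_distrr; apply: eq_bigr => i _; rewrite exprD.
Qed.

Lemma blockE r a : block r a = mx22 (r * qint r a) ((- r ^+ 2) ^+ a) 1 0.
Proof. by rewrite /block shearX mx22M; move: (_ ^+ a) => u; congr mx22; ring. Qed.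

(** Every cyclic word with both letters has a place where sigma_2 is followed by
    sigma_1, and it is cut there. *)
Lemma rot_false_true s : true \in s -> false \in s ->
  exists u v w, s = u ++ v /\ v ++ u = false :: rcons w true.
Proof.
(* Either sigma_2 sigma_1 occurs inside the word, or only across its ends. *)
have split_tf z : (exists p q, z = p ++ [:: true, false & q]) \/
    exists m n, z = nseq m false ++ nseq n true.
  elim: z => [|y z [[p [q ->]]|[m [n ->]]]]; first by right; exists 0, 0.
    by left; exists (y :: p), q.
  case: y; last by right; exists m.+1, n.
  by case: m => [|m]; [right; exists 0, n.+1 | left; exists [::], (nseq m false ++ nseq n true)].
move=> s1 s0; have [[p [q sE]]|[m [n sE]]] := split_tf s.
  exists (rcons p true), (false :: q), (q ++ p).
  by rewrite sE cat_rcons /= rcons_cat.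
rewrite sE in s1 s0 *; move: s1 s0; rewrite !mem_cat !mem_nseq /= !andbT !andbF orbF.
case: m n {sE} => [|m] [|n] // _ _.
exists [::], (nseq m.+1 false ++ nseq n.+1 true), (nseq m false ++ nseq n true).
rewrite cats0 rcons_cat; split=> //; congr (_ :: (_ ++ _)).
by elim: n => //= n <-.
Qed.

End Words.

(** * Eigenvalues *)

Section Burau.
Context {K : comNzRingType}.
Implicit Types (r : K) (i : bool).

Definition burau_eval (t : K) i : 'M[K]_2 :=
  if i then mx22 1 0 t (- t) else mx22 (- t) 1 0 1.

(** Conjugation by diag(r, 1) is not available when r = 0. The form of the
    entries recorded here gives the same characteristic polynomial for both
    products without dividing by r. *)
Lemma burau_shear_prod r (s : seq bool) : exists a b c d,
  \prod_(i <- s) burau_eval (r ^+ 2) i = mx22 a b (r ^+ 2 * c) d /\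
  \prod_(i <- s) shear_letter r i = mx22 a (r * b) (r * c) d.
Proof.
elim: s => [|i s [a [b [c [d [IH1 IH2]]]]]].
  by exists 1, 0, 0, 1; rewrite !big_nil mx22_1 !mulr0.
rewrite !big_cons {}IH1 {}IH2; case: i => /=.
  rewrite /shear_letter !mx22M; exists a, b, (a - r ^+ 2 * c), (r ^+ 2 * b - r ^+ 2 * d).
  by split; congr mx22; ring.
rewrite /shear_letter !mx22M.
exists (- r ^+ 2 * a + r ^+ 2 * c), (- r ^+ 2 * b + d), c, d.
by split; congr mx22; ring.
Qed.

End Burau.

Lemma det_mx22 (K : comNzRingType) (a b c d : K) :
  \det (mx22 a b c d) = a * d - b * c.
Proof.
rewrite (expand_det_row _ ord0) !big_ord_recl big_ord0 /cofactor !det_mx11.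
by rewrite !mxE /= ?expr0 ?expr1; ring.
Qed.

Lemma eigenvalue_det (K : fieldType) n (A : 'M[K]_n) a :
  eigenvalue A a = (\det (A - a%:M) == 0).
Proof.
apply/eigenvalueP/det0P => [[v Av v0]|[v v0 Av]]; exists v => //.
  by rewrite mulmxBr Av mul_mx_scalar subrr.
by apply/eqP; rewrite -subr_eq0 -mul_mx_scalar -mulmxBr Av.
Qed.

Lemma eigenvalue_mx22 (K : fieldType) (a b c d x : K) :
  eigenvalue (mx22 a b c d) x = ((a - x) * (d - x) - b * c == 0).
Proof.
rewrite eigenvalue_det -det_mx22; congr (\det _ == 0).
apply/matrixP => i j; rewrite !mxE.
by case: i => [[|[|//]] ?]; case: j => [[|[|//]] ?]; rewrite /= ?mulr1n ?mulr0n ?subr0.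
Qed.

Lemma eigenvalue_burau_shear (K : fieldType) (r x : K) (s : seq bool) :
  eigenvalue (\prod_(i <- s) burau_eval (r ^+ 2) i) x =
  eigenvalue (\prod_(i <- s) shear_letter r i) x.
Proof.
have [a [b [c [d [-> ->]]]]] := burau_shear_prod r s.
by rewrite !eigenvalue_mx22; congr (_ == 0); ring.
Qed.

Lemma eigenvalue_mulC (K : fieldType) (n : nat) (A B : 'M[K]_n.+1) x :
  x != 0 -> eigenvalue (A * B) x -> eigenvalue (B * A) x.
Proof.
move=> x0 /eigenvalueP[v vAB v0]; apply/eigenvalueP; exists (v *m A).
  by rewrite -mulmxA -[B * A]/(B *m A) !mulmxA -(mulmxA v) -[A *m B]/(A * B) vAB scalemxAl.
apply: contraNneq v0 => vA0; move: vAB.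
rewrite -[A * B]/(A *m B) mulmxA vA0 mul0mx => /esym/eqP.
by rewrite scaler_eq0 (negbTE x0).
Qed.

Lemma eigenvalueX (K : fieldType) (n : nat) (A : 'M[K]_n.+1) x m :
  eigenvalue A x -> eigenvalue (A ^+ m) (x ^+ m).
Proof.
move=> /eigenvalueP[v vA v0]; apply/eigenvalueP; exists v => //.
elim: m => [|m IH]; first by rewrite !expr0 mulmx1 scale1r.
by rewrite exprSr -[_ * A]/(_ *m A) mulmxA IH -scalemxAl vA scalerA exprSr.
Qed.

(** * Normal forms of words in the shear and the swap *)

(** The exponents are at least 2, so that nothing expands, except at the end,
    where a word finishes with S^d J for any d or with S; the ending 1, 0 stands
    for the latter, as S J S^0 J = S. *)
Fixpoint tame (l : seq nat) : bool :=
  if l is b :: l' then [|| l' == [::], (1 < b)%N && tame l' | l == [:: 1; 0]]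
  else true.

Lemma tame_behead b l : tame (b :: l) -> tame l.
Proof. by case/or3P => [/eqP->|/andP[]|/eqP[_ ->]]. Qed.

Section Normal.
Context {K : numDomainType}.
Implicit Types (r : K) (M : 'M[K]_2).

(** The first exponent a is left free, as it is where new letters are added. *)
Definition tame_form r M := exists (c : K) (e : bool) (a : nat) (l : seq nat),
  [/\ `|c| <= 1, tame l & M = c *: (swap ^+ e * (block r a * blocks r l))].

Lemma tame_form_swap r M : tame_form r M -> tame_form r (swap * M).
Proof.
move=> [c [e [a [l [c1 tl ->]]]]]; exists c, (~~ e), a, l; split=> //.
rewrite -scalerAr; congr (_ *: _).
by case: e; rewrite ?expr0 ?expr1 ?mul1r // swapKl.
Qed.

(** The only case with some content is S J S^a J ...: the run a becomes interior,
    so if a = 0 it has to vanish with the swaps around it, and if a = 1 the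
    Garside relation consumes it, unless the next run is empty or missing, in
    which case the word ends there. *)
Lemma tame_form_shear r M : `|r| <= 1 -> tame_form r M -> tame_form r (shear r * M).
Proof.
move=> r1 [c [e [a [l [c1 tl ->]]]]]; rewrite -scalerAr.
case: e; rewrite ?expr0 ?expr1 ?mul1r; last first.
  by exists c, false, a.+1, l; split; rewrite // expr0 mul1r blockS mulrA.
have SJ : shear r * swap = block r 1 by rewrite blockS block0.
case: a => [|[|a]].
- rewrite block0 swapKl; case: l tl => [|b l] tl.
    exists c, false, 1, [:: 0]; split=> //.
    by rewrite blocks_cons blocks_nil block0 -SJ expr0 mul1r !mulr1 -mulrA swapK mulr1.
  exists c, false, b.+1, l; split; rewrite ?(tame_behead tl) //.
  by rewrite expr0 mul1r blocks_cons mulrA -blockS.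
- case: l tl => [|[|b] l] tl.
  + exists c, false, 1, [:: 1]; split=> //.
    by rewrite expr0 mul1r blocks_cons -SJ !mulrA.
  + have -> : l = [::] by case/or3P: tl => [/eqP//|//|/eqP//].
    exists c, false, 1, [:: 1; 0]; split=> //.
    by rewrite expr0 mul1r !blocks_cons -SJ !mulrA.
  + exists (c * - r ^+ 3), true, b, l; split.
    * by rewrite normrM normrN normrX mulr_ile1 ?exprn_ile1 ?exprn_ge0.
    * exact: tame_behead tl.
    rewrite expr1 -scalerA; congr (_ *: _).
    rewrite blocks_cons (blockS r b) -SJ !mulrA shear_swap_garside.
    by rewrite -!scalerAl ?mulrA.
- exists c, false, 1, (a.+2 :: l); split=> //; first by rewrite /= tl orbT.
  by rewrite expr0 mul1r blocks_cons -SJ !mulrA.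
Qed.

Lemma tame_form_blocks r l : `|r| <= 1 -> tame_form r (blocks r l).
Proof.
move=> r1; elim: l => [|a l IH].
  exists 1, true, 0, [::]; split; rewrite ?normr1 //.
  by rewrite blocks_nil block0 expr1 swapKl scale1r.
rewrite blocks_cons /block -mulrA; elim: a => [|a IHa].
  by rewrite expr0 mul1r; apply: tame_form_swap.
by rewrite exprS -mulrA; apply: tame_form_shear.
Qed.

End Normal.

(** * The l1 norm of words *)

Section L1.
Context {K : numFieldType}.
Implicit Types (r : K) (v : 'rV[K]_2) (a : nat) (l : seq nat).

(** The l1 norm fits row vectors: the swap is an isometry, and a block sends the
    second coordinate to the first one without loss. *)
Definition l1norm v := `|v 0 0| + `|v 0 1|.

Lemma mulmx_mx22 v (a b c d : K) :
  ((v *m mx22 a b c d) 0 0 = v 0 0 * a + v 0 1 * c) *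
  ((v *m mx22 a b c d) 0 1 = v 0 0 * b + v 0 1 * d).
Proof.
have e : lift ord0 ord0 = 1 :> 'I_2 by exact: val_inj.
by rewrite !mxE !big_ord_recl !big_ord0 !mxE /= !addr0 e.
Qed.

Lemma l1norm_ge0 v : 0 <= l1norm v.
Proof. by rewrite addr_ge0. Qed.

Lemma l1norm_eq0 v : (l1norm v == 0) = (v == 0).
Proof.
rewrite paddr_eq0 // !normr_eq0; apply/andP/eqP => [[/eqP v0 /eqP v1]|->].
  apply/matrixP => i j; rewrite !mxE (ord1 i).
  case: j => [[|[|//]] p]; first by rewrite -[RHS]v0; congr (v _ _); exact: val_inj.
  by rewrite -[RHS]v1; congr (v _ _); exact: val_inj.
by rewrite !mxE eqxx.
Qed.

Lemma l1normZ (c : K) v : l1norm (c *: v) = `|c| * l1norm v.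
Proof. by rewrite /l1norm !mxE !normrM mulrDr. Qed.

Lemma l1norm_swap v : l1norm (v *m swap) = l1norm v.
Proof. by rewrite /l1norm !mulmx_mx22 !mulr0 !mulr1 add0r addr0 addrC. Qed.

(** The factor by which a block can multiply the first coordinate: the l1 norm
    of the first row of its matrix. *)
Definition cost r a := `|r * qint r a| + `|r| ^+ (2 * a).

Lemma l1norm_block r a v :
  l1norm (v *m block r a) <= cost r a * `|v 0 0| + `|v 0 1|.
Proof.
rewrite /l1norm blockE !mulmx_mx22 mulr1 mulr0 addr0 !normrM normrX normrN normrX.
rewrite -exprM /cost mulrDl addrAC (mulrC _ `|v 0 0|) (mulrC _ `|v 0 0|) normrM.
by rewrite lerD2r (le_trans (ler_normD _ _)) // !normrM.
Qed.

Lemma cost0 r : cost r 0 = 1.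
Proof. by rewrite /cost /qint big_ord0 mulr0 normr0 expr0 add0r. Qed.

Lemma cost1 r : cost r 1 = `|r| + `|r| ^+ 2.
Proof. by rewrite /cost /qint big_ord1 expr0 mulr1. Qed.

(** From [a + b] = [a] + (-t)^a [b], one gets
    c(a + b) <= |r [a]| + |t|^a c(b). *)
Lemma costD r a b : cost r b <= 1 -> cost r (a + b) <= cost r a.
Proof.
move=> b1; rewrite /cost qintD mulnDr exprD mulrDr.
apply: (@le_trans _ _ (`|r * qint r a| + `|r| ^+ (2 * a) * cost r b)).
  rewrite /cost mulrDr addrA lerD2r (le_trans (ler_normD _ _)) // lerD2l.
  by rewrite mulrCA normrM normrX normrN normrX -exprM.
by rewrite lerD2l ler_piMr ?exprn_ge0.
Qed.

Section Contraction.
Context (r : K) (cost2 : cost r 2 < 1) (cost3 : cost r 3 < 1).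

Lemma norm_lt1 : `|r| < 1.
Proof.
have : `|r| ^+ 4 < 1 by apply: le_lt_trans cost2; rewrite lerDr.
by rewrite expr_lt1.
Qed.

(** Every exponent from 4 on is a smaller one, at least 2, plus 2. *)
Lemma cost_lt1 a : (1 < a)%N -> cost r a < 1.
Proof.
have [n] := ubnP a; elim: n a => // n IH [|[|[|[|a]]]] //= an _.
rewrite -[a.+4]/(2 + a.+2)%N; apply: le_lt_trans cost2.
apply: costD; apply/ltW/IH => //; exact: ltnW.
Qed.

Lemma cost_le2 a : cost r a <= 2.
Proof.
case: a => [|[|a]].
- by rewrite cost0 ler1n.
- by rewrite cost1 -[2]/(1 + 1) lerD ?exprn_ile1 ?(ltW norm_lt1).
by rewrite ltW // (lt_trans (cost_lt1 _)) // ltr1n.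
Qed.

Lemma l1norm_block_le a v : (1 < a)%N -> l1norm (v *m block r a) <= l1norm v.
Proof.
move=> a1; apply: le_trans (l1norm_block _ _ _) _.
by rewrite lerD2r ler_piMl // ltW ?cost_lt1.
Qed.

Lemma l1norm_block_le2 a v : l1norm (v *m block r a) <= 2 * l1norm v.
Proof.
apply: le_trans (l1norm_block _ _ _) _; rewrite mulrDr.
by rewrite lerD ?ler_wpM2r ?cost_le2 // ler_peMl // ler1n.
Qed.

(** A single block is isometric on vectors (0, y), but it sends them to (y, 0),
    on which the next block contracts. *)
Lemma l1norm_block2_lt a b v : (1 < a)%N -> (1 < b)%N -> v != 0 ->
  l1norm (v *m block r a *m block r b) < l1norm v.
Proof.
move=> a1 b1 v0; have [x0|x0] := eqVneq (v 0 0) 0; last first.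
  apply: le_lt_trans (l1norm_block_le _ b1) _.
  apply: le_lt_trans (l1norm_block _ _ _) _.
  by rewrite ltrD2r gtr_pMl ?normr_gt0 ?cost_lt1.
have y0 : v 0 1 != 0.
  by apply: contraNneq v0 => y0; rewrite -l1norm_eq0 /l1norm x0 y0 !normr0 addr0.
apply: le_lt_trans (l1norm_block _ _ _) _.
rewrite blockE !mulmx_mx22 /l1norm x0 !mul0r !mulr1 !mulr0 !add0r normr0 !addr0 add0r.
by rewrite gtr_pMl ?normr_gt0 ?cost_lt1.
Qed.

Lemma mulmx_blocks_cons a l v :
  v *m blocks r (a :: l) = v *m block r a *m blocks r l.
Proof. by rewrite blocks_cons -mulmxA. Qed.

Lemma l1norm_blocks_le l v : all (leq 2) l -> l1norm (v *m blocks r l) <= l1norm v.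
Proof.
elim: l v => [|a l IH] v /=; first by rewrite blocks_nil mulmx1.
move=> /andP[a1 /IH lP]; rewrite mulmx_blocks_cons.
by apply: le_trans (lP _) _; apply: l1norm_block_le.
Qed.

(** Only the exponent 1 can expand, and a tame list contains it at most once. *)
Lemma l1norm_tame l v : tame l -> l1norm (v *m blocks r l) <= 2 * l1norm v.
Proof.
elim: l v => [|a l IH] v.
  by rewrite blocks_nil mulmx1 ler_peMl ?l1norm_ge0 ?ler1n.
rewrite mulmx_blocks_cons => /or3P[/eqP->|/andP[a1 tl]|/eqP[-> ->]].
- by rewrite blocks_nil mulmx1 l1norm_block_le2.
- by rewrite (le_trans (IH _ tl)) // ler_wpM2l // l1norm_block_le.
by rewrite blocks_cons blocks_nil mulr1 block0 l1norm_swap l1norm_block_le2.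
Qed.

(** In a normal form only the first exponent and one in the tame part can
    expand, each by a factor at most 2. *)
Lemma l1norm_blocks_le4 l v : l1norm (v *m blocks r l) <= 4 * l1norm v.
Proof.
have [c [e [a [l' [c1 tl ->]]]]] := tame_form_blocks l (ltW norm_lt1).
rewrite -scalemxAr l1normZ.
apply: (@le_trans _ _ (1 * l1norm (v *m (swap ^+ e * (block r a * blocks r l'))))).
  by rewrite ler_wpM2r ?l1norm_ge0.
have mulA (A B : 'M[K]_2) u : u *m (A * B) = u *m A *m B by exact: mulmxA.
rewrite mul1r (mulA _ (_ ^+ e)) (mulA _ (block r a)); apply: le_trans (l1norm_tame _ tl) _.
rewrite [4](natrM _ 2 2) -mulrA ler_pM2l //; apply: le_trans (l1norm_block_le2 _ _) _.
by rewrite ler_pM2l //; case: e; rewrite ?expr1 ?expr0 ?l1norm_swap ?mulmx1.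
Qed.

End Contraction.
End L1.

(** * Spectral radius of words *)

Lemma bernoulli_ineq (K : numDomainType) (d : K) n : 0 <= d -> 1 + d *+ n <= (1 + d) ^+ n.
Proof.
move=> d0; elim: n => [|n IH]; first by rewrite mulr0n addr0.
rewrite exprS mulrSr addrA.
apply: (@le_trans _ _ ((1 + d) * (1 + d *+ n))); last by rewrite ler_wpM2l ?addr_ge0.
by rewrite mulrDl mul1r lerD2l ler_peMr // lerDl mulrn_wge0.
Qed.

Lemma bounded_powers_le1 (R : realType) (x k : R[i]) :
  0 <= x -> 0 <= k -> (forall n, x ^+ n <= k) -> x <= 1.
Proof.
move=> x0 k0 xk; have := xk; rewrite -(RRe_real (ger0_real x0)) -(RRe_real (ger0_real k0)).
move: (complex.Re x) (complex.Re k) => {x x0 xk} y {k0} c yc; rewrite lecR.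
rewrite leNgt; apply/negP => y1.
have d0 : 0 < y - 1 by rewrite subr_gt0.
have [n cn] : exists n, c < (y - 1) *+ n.
  exists (Num.bound `|c / (y - 1)|).
  rewrite -mulr_natr mulrC -ltr_pdivrMr //.
  exact: le_lt_trans (ler_norm _) (archi_boundP (normr_ge0 _)).
have := yc n; rewrite -rmorphXn lecR /= => /le_lt_trans /(_ cn).
rewrite ltNge; apply/negP/negPn.
have := bernoulli_ineq n (ltW d0); rewrite [1 + (y - 1)]addrC subrK; apply: le_trans.
by rewrite lerDr.
Qed.

Section Spectrum.
Context {R : realType} (r : R[i]) (cost2 : cost r 2 < 1) (cost3 : cost r 3 < 1).

Lemma blocksX l n : exists l', blocks r l ^+ n = blocks r l'.
Proof.
elim: n => [|n [l' IH]]; first by exists [::]; rewrite blocks_nil.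
by exists (l ++ l'); rewrite exprS IH blocks_cat.
Qed.

(** The bound 4 holds for all words, hence for all powers of this one. *)
Lemma eigenvalue_blocks_le1 l x : eigenvalue (blocks r l) x -> `|x| <= 1.
Proof.
move=> xl; apply: (@bounded_powers_le1 _ _ 4) => // n.
have [l' l'E] := blocksX l n.
have := eigenvalueX n xl; rewrite l'E => /eigenvalueP[v vl' v0].
rewrite -normrX -(@ler_pM2r _ (l1norm v)); last first.
  by rewrite lt_def l1norm_ge0 l1norm_eq0 v0.
by rewrite -l1normZ -vl' l1norm_blocks_le4.
Qed.

(** Repeating the word gives room on both sides: the square suffices for a strict
    contraction, and in the cube some exponent 1 has neighbours on both sides. *)
Lemma eigenvalue_blocks_lt1 l x : l != [::] -> all (leq 1) l ->
  eigenvalue (blocks r l) x -> `|x| < 1.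
Proof.
move=> l0 l1 xl; have [l2|/allPn[b bl b2]] := boolP (all (leq 2) l).
  have := eigenvalueX 2 xl; rewrite expr2 -blocks_cat.
  case: l l0 {l1 xl} l2 => // a l _ l2 /=.
  have [b [m [-> /andP[b2 m2]]]] : exists b m, l ++ a :: l = b :: m /\ all (leq 2) (b :: m).
    case: l l2 => [|b m] /=; first by exists a, [::].
    by case/and3P=> a2 b2 m2; exists b, (m ++ [:: a, b & m]); rewrite all_cat /= a2 b2 m2.
  case/andP: l2 => a2 _.
  move=> /eigenvalueP[v vE v0]; have v0' : 0 < l1norm v.
    by rewrite lt_def l1norm_ge0 l1norm_eq0 v0.
  rewrite -(@expr_lt1 _ 2) // -normrX -(ltr_pM2r v0') mul1r -l1normZ -vE.
  rewrite !mulmx_blocks_cons.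
  by apply: le_lt_trans (l1norm_blocks_le _ _ _ m2) (l1norm_block2_lt _ _ _ _ v0).
have b1 : b = 1 by apply/eqP; rewrite eqn_leq (allP l1 _ bl) andbT leqNgt.
move: bl; rewrite {b b2}b1 => bl.
have [p [a [c [q lE]]]] : exists p a c q, l ++ l ++ l = p ++ [:: a.+1, 1, c.+1 & q].
  case/splitPr: bl l1 {l0 xl} => p q l1.
  have [y [a yE]] : exists y a, 1 :: q ++ p = rcons y a.
    by exists (belast 1 (q ++ p)), (last 1 (q ++ p)); rewrite -lastI.
  case zE: (q ++ p ++ 1 :: q) => [|c z]; first by case: (q) zE => //; case: (p).
  have l1P : all (leq 1) (1 :: q ++ p) /\ all (leq 1) (q ++ p ++ 1 :: q).
    by move: l1; rewrite /= !all_cat /= => /andP[-> ->].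
  have [a0 c0] : (0 < a)%N /\ (0 < c)%N.
    move: l1P; rewrite yE zE all_rcons => -[/andP[? _] /andP[? _]] //.
  (* The exponent 1 is taken in the second copy of the word, between the last
     exponent of 1 :: q ++ p and the first one of q ++ p ++ 1 :: q. *)
  exists (p ++ y), a.-1, c.-1, z; rewrite !prednK // -zE.
  transitivity (p ++ (1 :: q ++ p) ++ 1 :: q ++ p ++ 1 :: q).
    by rewrite -!catA /= -!catA.
  by rewrite yE cat_rcons -[RHS]catA.
have := eigenvalueX 3 xl.
rewrite !exprS expr0 mulr1 -!blocks_cat lE blocks_garside -!exprS.
have r1 := norm_lt1 cost2; move=> /eigenvalueP[v vE v0].
rewrite -(@expr_lt1 _ 3) // -normrX.
have [r0|r0] := eqVneq (- r ^+ 3) 0.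
  move: vE; rewrite r0 scale0r mulmx0 => /esym/eqP.
  by rewrite scaler_eq0 (negbTE v0) orbF => /eqP ->; rewrite normr0.
have : eigenvalue (blocks r (p ++ [:: a, c & q])) ((- r ^+ 3)^-1 * x ^+ 3).
  by apply/eigenvalueP; exists v; rewrite // -scalerA -vE -scalemxAr scalerK.
move=> /eigenvalue_blocks_le1; rewrite normrM normfV ler_pdivrMl ?normr_gt0 //.
by rewrite mulr1 => /le_lt_trans; apply; rewrite normrN normrX expr_lt1.
Qed.

Lemma eigenvalue_word_lt1 (s : seq bool) x : true \in s -> false \in s ->
  eigenvalue (\prod_(i <- s) shear_letter r i) x -> `|x| < 1.
Proof.
move=> s1 s0; have [u [v [w [-> vuE]]]] := rot_false_true s1 s0.
have [->|x0] := eqVneq x 0; first by rewrite normr0.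
rewrite big_cat /= => /(eigenvalue_mulC x0).
have [l /andP[l0 l1]] := blocks_of_word r w false.
by rewrite expr0 mul1r -vuE big_cat /= => ->; apply: eigenvalue_blocks_lt1.
Qed.

End Spectrum.

(** * Openness of the region *)

Section Openness.
Context {C : numClosedFieldType}.

Lemma sqrtC_dist (x y : C) : 0 <= x -> 0 <= y ->
  `|sqrtC x - sqrtC y| ^+ 2 <= `|x - y|.
Proof.
move=> x0 y0.
have -> : x - y = (sqrtC x - sqrtC y) * (sqrtC x + sqrtC y).
  by rewrite -subr_sqr !sqrtCK.
rewrite normrM expr2 ler_wpM2l // [X in _ <= X]ger0_norm ?addr_ge0 ?sqrtC_ge0 //.
by rewrite (le_trans (ler_normB _ _)) // !ger0_norm ?sqrtC_ge0.
Qed.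

Lemma sqrtC_norm_continuous : continuous (fun t : C => sqrtC `|t| : C).
Proof.
move=> t; apply/(@cvgrPdist_lt _ C^o _ (nbhs t) (nbhs_filter t)) => e e0.
have e2 : 0 < e ^+ 2 by rewrite exprn_gt0.
have := @nbhsx_ballx _ (C^o : pseudoMetricType C) t _ e2; rewrite -ball_normE.
apply: filterS => u /= tu.
rewrite -(@ltr_pXn2r _ 2) ?nnegrE // ?ltW //.
apply: le_lt_trans (sqrtC_dist _ _) _ => //.
by apply: le_lt_trans tu; exact: ler_dist_dist.
Qed.

(** The order of C is partial, so that {z | z < 1} is not open. The function is
    nonnegative, however, and the set is the preimage of the unit ball. *)
Lemma open_sqrt_norm_lt1 (f g : C -> C) : continuous f -> continuous g ->
  open [set t : C | sqrtC `|t| * `|f t| + `|g t| < 1].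
Proof.
move=> fc gc; pose F (t : C) : C := sqrtC `|t| * `|f t| + `|g t|.
have Fc : continuous F.
  move=> t; apply: (@cvgD _ C^o _ (nbhs t) (nbhs_filter t)
    (fun u => sqrtC `|u| * `|f u|) (fun u => `|g u|)); last first.
    apply: (@continuous_comp _ _ _ g (fun z : C^o => `|z|)); first exact: gc.
    exact: (@norm_continuous _ C^o).
  apply: (@cvgM _ _ (nbhs t) (nbhs_filter t) (fun u : C => sqrtC `|u|) (fun u : C => `|f u|)).
    exact: sqrtC_norm_continuous.
  apply: (@continuous_comp _ _ _ f (fun z : C^o => `|z|)); first exact: fc.
  exact: (@norm_continuous _ C^o).
have -> : [set t : C | sqrtC `|t| * `|f t| + `|g t| < 1] = F @^-1` ball (0 : C^o) 1.
  have F0 t : 0 <= F t by rewrite /F addr_ge0 // mulr_ge0 // sqrtC_ge0.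
  by apply/seteqP; split=> t; rewrite -ball_normE /= sub0r normrN (ger0_norm (F0 t)).
by apply: open_comp (@ball_open _ C^o _ _) => t _; apply: Fc.
Qed.

Lemma sqrt_norm_region_open :
  open ([set t : C | sqrtC `|t| * `|1 - t| + `|t| ^+ 2 < 1 /\
           sqrtC `|t| * `|1 - t + t ^+ 2| + `|t| ^+ 3 < 1]).
Proof.
have id_ct (t : C) : (fun u : C => u) @ t --> t by exact: cvg_id.
have sub_ct (t : C) : (fun u : C => 1 - u) @ t --> 1 - t.
  by apply: (@cvgB _ C^o _ (nbhs t) (nbhs_filter t)); [exact: cvg_cst|exact: id_ct].
have sqr_ct (t : C) : (fun u : C => u ^+ 2) @ t --> t ^+ 2.
  by rewrite expr2; apply: (@cvgM _ _ (nbhs t) (nbhs_filter t)); exact: id_ct.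
have cub_ct (t : C) : (fun u : C => u ^+ 3) @ t --> t ^+ 3.
  by rewrite exprS; apply: (@cvgM _ _ (nbhs t) (nbhs_filter t)); [exact: id_ct|exact: sqr_ct].
have -> : [set t : C | sqrtC `|t| * `|1 - t| + `|t| ^+ 2 < 1 /\
           sqrtC `|t| * `|1 - t + t ^+ 2| + `|t| ^+ 3 < 1] =
   [set t | sqrtC `|t| * `|1 - t| + `|t ^+ 2| < 1] `&`
   [set t | sqrtC `|t| * `|1 - t + t ^+ 2| + `|t ^+ 3| < 1].
  by apply/seteqP; split=> t /=; rewrite !normrX.
apply: openI; apply: open_sqrt_norm_lt1; [exact: sub_ct|exact: sqr_ct| |exact: cub_ct].
by move=> t; apply: (@cvgD _ C^o _ (nbhs t) (nbhs_filter t)); [exact: sub_ct|exact: sqr_ct].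
Qed.

End Openness.

Lemma T_set_open (R : realType) : open (T_set R : set R[i]^o).
Proof. exact: (@sqrt_norm_region_open R[i]). Qed.

(** * Positive braids on the region *)

Section Tset.
Context {R : realType}.
Implicit Types t : R[i].

Lemma sqrt_cost2 t : cost (sqrtC t) 2 = sqrtC `|t| * `|1 - t| + `|t| ^+ 2.
Proof.
rewrite /cost /qint !big_ord_recl big_ord0 /= addr0 expr0 expr1 sqrtCK normrM.
by rewrite norm_rootC exprM sqrtCK.
Qed.

Lemma sqrt_cost3 t :
  cost (sqrtC t) 3 = sqrtC `|t| * `|1 - t + t ^+ 2| + `|t| ^+ 3.
Proof.
rewrite /cost /qint !big_ord_recl big_ord0 /= addr0 expr0 expr1 sqrtCK normrM.
by rewrite norm_rootC exprM sqrtCK /= sqrrN addrA.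
Qed.

Lemma burau_at_prod (s : seq bool) t :
  burau_at (\big[*%g/1%g]_(i <- s) (if i then sigma2 else sigma1)) t =
  \prod_(i <- s) burau_eval t i.
Proof.
rewrite /burau_at (burau_polyE (esym (burau_prod_gen s))).
pose f : {rmorphism {poly int} -> R[i]} := horner_eval t \o map_poly intr.
rewrite -/(map_mx f _).
elim: s => [|i s IH]; first by rewrite !big_nil; exact: (map_mx1 f).
rewrite !big_cons -IH -[LHS]/(map_mx f (burau_gen i *m _)) map_mxM; congr (_ *m _).
have fX : f 'X = t by rewrite /f /= map_polyX horner_evalE hornerX.
apply/matrixP => j k; case: i; rewrite !mxE;
by case: (j == 0); case: (k == 0); rewrite ?rmorphN ?rmorph1 ?rmorph0 ?fX.
Qed.

End Tset.

Theorem theorem1p3 (R : realType) :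
  open (T_set R : set R[i]^o) /\
  T_set R `<=` [set t : R[i] | `|t| < 1] /\
  forall w : Br3, positive w ->
    ~ is_power_of sigma1 w -> ~ is_power_of sigma2 w ->
    R_set R w `&` T_set R = set0.
Proof.
split; first exact: T_set_open.
split=> [t [t2 _]|_ [s ->] s1 s2] /=.
  have : `|t| ^+ 2 < 1 by apply: le_lt_trans t2; rewrite lerDr mulr_ge0 ?sqrtC_ge0.
  by rewrite expr_lt1.
set w := (X in R_set R X) in s1 s2 *.
rewrite -subset0 => t [[_ rho1] [t2 t3]].
have [[x xt xE] _] := spectral_radius_max (burau_at w t).
move: xE; rewrite -/(rho _ t) rho1 => xE.
suff : `|x| < 1 by rewrite xE ltxx.
move: xt; rewrite burau_at_prod -[t in burau_eval t]sqrtCK eigenvalue_burau_shear.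
(* A braid without one of the generators is a power of the other one. *)
have missing_letter b : b \notin s -> is_power_of (if b then sigma1 else sigma2) w.
  rewrite {}/w in s1 s2 rho1 *; move=> bs; exists (size s); left.
  elim: s bs {s1 s2 rho1} => [|c s IH]; first by rewrite big_nil.
  rewrite inE negb_or => /andP[bc bs]; rewrite big_cons IH // expgS; congr (_ * _)%g.
  by case: b c bc {bs IH} => -[].
by apply: eigenvalue_word_lt1; rewrite ?sqrt_cost2 ?sqrt_cost3 //; apply/negPn/negP => /missing_letter.
Qed.
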